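(* Let $(X,\tau)$ be a topological space. Then $(X,\tau)$ is a semi-$T_1$-space if and only if every subset of $X$ is a $\Lambda_s$-set (or, equivalently, if and only if every subset of $X$ is a $V_s$-set).
   Context: Let $(X,\tau)$ be a topological space. A subset $A\subseteq X$ is semi-open if there is $O\in\tau$ with $O\subseteq A\subseteq \mathrm{Cl}(O)$, where $\mathrm{Cl}$ denotes closure; a subset is semi-closed if its complement is semi-open. $SO(X,\tau)$ denotes the family of all semi-open sets. For $B\subseteq X$, $B^c = X\setminus B$, and define $B^{\Lambda_s}=\bigcap\{O : O\supseteq B,\ O\in SO(X,\tau)\}$ and $B^{V_s}=\bigcup\{F : F\subseteq B,\ F^c\in SO(X,\tau)\}$. A subset $B$ is a $\Lambda_s$-set if $B=B^{\Lambda_s}$, and a $V_s$-set if $B=B^{V_s}$. The space $(X,\tau)$ is a semi-$T_1$-space if for each pair of distinct points $x,y\in X$ there is a semi-open set containing $x$ but not $y$ and a semi-open set containing $y$ but not $x$ (equivalently, every singleton is semi-closed). *)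

(* Defs.v *)
From mathcomp Require Import all_boot.
From mathcomp Require Import classical_sets topology.

Set Implicit Arguments.
Unset Strict Implicit.
Unset Printing Implicit Defensive.

Local Open Scope classical_set_scope.

Definition semi_open (X : topologicalType) (A : set X) : Prop :=
  exists O : set X, [/\ open O, O `<=` A & A `<=` closure O].

Definition Lambda_s (X : topologicalType) (B : set X) : set X :=
  \bigcap_(O in [set O : set X | B `<=` O /\ semi_open O]) O.

Definition V_s (X : topologicalType) (B : set X) : set X :=
  \bigcup_(F in [set F : set X | F `<=` B /\ semi_open (~` F)]) F.

Definition Lambda_s_set (X : topologicalType) (B : set X) : Prop :=
  B = Lambda_s B.

Definition V_s_set (X : topologicalType) (B : set X) : Prop :=
  B = V_s B.

Definition semi_T1 (X : topologicalType) : Prop :=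
  forall x y : X, x <> y ->
    (exists U : set X, [/\ semi_open U, U x & ~ U y]) /\
    (exists V : set X, [/\ semi_open V, V y & ~ V x]).

(* Main.v *)
(** Since unions of semi-open sets are semi-open, X is semi-T1 exactly when
    singletons are semi-closed.  A set is a V_s-set when it is a union of
    semi-closed sets, so singletons being semi-closed amounts to every set
    being a V_s-set; complementation exchanges V_s-sets and Lambda_s-sets. *)

Require Import Defs.
From mathcomp Require Import all_boot.
From mathcomp Require Import boolp classical_sets topology.

Local Open Scope classical_set_scope.

(** The interior of the union is a witness: it contains the open witness [O] of each member [A], so
    its closure contains [closure O], hence [A]. *)
Lemma semi_open_bigcup (X : topologicalType) (D : set (set X)) :
  (forall A, D A -> semi_open A) -> semi_open (\bigcup_(A in D) A).
Proof.
move=> soD; exists (interior (\bigcup_(A in D) A)); split.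
- exact: open_interior.
- exact: interior_subset.
- move=> x [A DA Ax]; have [O [oO OA AO]] := soD A DA.
  apply: (closureS _ (AO x Ax)) => y Oy.
  have : nbhs y O by exact: open_nbhs_nbhs.
  by apply: filterS => z /OA Az; exists A.
Qed.

Lemma semi_T1P (X : topologicalType) :
  semi_T1 X <-> forall x : X, semi_open (~` [set x]).
Proof.
split=> [T1 x | so1 x y xy].
- suff -> : ~` [set x] = \bigcup_(A in [set A | semi_open A /\ ~ A x]) A.
    by apply: semi_open_bigcup => A [].
  apply/seteqP; split=> [y yx | y [A [_ nAx] Ay] yx].
  + by have [[U [soU Uy nUx]] _] := T1 y x yx; exists U.
  + by apply: nAx; rewrite -yx.
- split; first by exists (~` [set y]); split=> //; apply.
  by exists (~` [set x]); split; [|move=> yx; apply: xy|apply].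
Qed.

Lemma semi_T1_V_s (X : topologicalType) :
  semi_T1 X <-> forall B : set X, V_s_set B.
Proof.
rewrite semi_T1P; split=> [so1 B | VB x].
- apply/seteqP; split=> [x Bx | x [F [FB _] Fx]]; last exact: FB.
  by exists [set x] => //; split=> // y ->.
(* Some semi-closed [F] inside the singleton contains [x], which forces [F] to be that singleton. *)
- have : V_s [set x] x by rewrite -VB.
  case=> F [Fx soF] xF; suff <- : F = [set x] by [].
  by apply/seteqP; split=> // y ->.
Qed.

(** De Morgan: complementation matches the semi-open supersets of [B] with the semi-closed subsets
    of its complement. *)
Lemma Lambda_sE (X : topologicalType) (B : set X) :
  Lambda_s B = ~` V_s (~` B).
Proof.
apply/seteqP; split=> [x LBx [F [FB soF] Fx] | x nVx O [BO soO]].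
- by apply: (LBx (~` F)) => //; split=> // y By /FB.
- apply: contrapT => nOx; apply: nVx; exists (~` O) => //.
  by split; [exact: subsetC | rewrite setCK].
Qed.

Lemma Lambda_s_setE (X : topologicalType) (B : set X) :
  Lambda_s_set B <-> V_s_set (~` B).
Proof.
rewrite /Lambda_s_set /V_s_set Lambda_sE.
by split=> [{1}-> | <-]; rewrite setCK.
Qed.

Theorem proposition3p7 (X : topologicalType) :
  (semi_T1 X <-> forall B : set X, Lambda_s_set B) /\
  (semi_T1 X <-> forall B : set X, V_s_set B).
Proof.
split; last exact: semi_T1_V_s.
(* Every set is a complement, so quantifying over all sets or over all complements is the same. *)
rewrite semi_T1_V_s; split=> VB B; first exact/Lambda_s_setE.
by rewrite -[B]setCK; apply/Lambda_s_setE.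
Qed.
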